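(* Let $1<p\le 2$, let $X$ be a $p$-uniformly smooth separable Banach space, and let $f=(f_j)_{j=0}^\infty$ be an $X$-valued conditionally symmetric martingale relative to a filtration $(\mathscr{F}_j)_{j=0}^\infty$. Then for all $\beta,r,b>0$ and $\alpha\ge 0$, $$\mathbb{P}\left\{\frac{\|f_n-f_0\|}{\big(\alpha+\beta S_{p,n}^p(f)\big)^{2/p}}\ge r,\ \frac{1}{S_{p,n}^p(f)}\le b\ \text{for some } n\right\}\le 4\exp\left\{-r^p\Big(\frac{\beta^2}{2bK}+\frac{\alpha\beta}{K}\Big)\right\},$$ where $K$ is a constant depending only on $X$ with $K\le D\,s_p(X)$ for a universal constant $D>0$.
   Context: $\rho_X(\tau)=\sup\{\frac{\|x+\tau y\|+\|x-\tau y\|}{2}-1:\|x\|=\|y\|=1\}$; $X$ is $p$-uniformly smooth if $\rho_X(\tau)\le s\tau^p$ for all $\tau>0$ for some $s>0$, and $s_p(X)$ is the infimum of such $s$. $d_{j,f}=f_j-f_{j-1}$ and $S_{p,n}(f)=(\sum_{j=1}^n\|d_{j,f}\|^p)^{1/p}$. $f$ is conditionally symmetric if $\mathbb{E}\varphi(d_{1,f},\dots,d_{j-1,f},d_{j,f})=\mathbb{E}\varphi(d_{1,f},\dots,d_{j-1,f},-d_{j,f})$ for all bounded continuous $\varphi:X^j\to\mathbb{R}$ and all $j\in\mathbb{N}$. $\mathscr{F}_0$ is trivial. *)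

(* Defs.v *)
From mathcomp Require Import all_boot all_order all_algebra.
From mathcomp Require Import all_classical all_reals all_analysis.
Import numFieldNormedType.Exports.
Import Order.TTheory GRing.Theory Num.Theory.
Set Implicit Arguments. Unset Strict Implicit. Unset Printing Implicit Defensive.
Local Open Scope classical_set_scope.
Local Open Scope ring_scope.

Section Defs.
Variable R : realType.

Definition rho_mod (X : normedModType R) (tau : R) : R :=
  sup [set z : R | exists x y : X, `|x| = 1 /\ `|y| = 1 /\
         z = (`|x + tau *: y| + `|x - tau *: y|) / 2 - 1].

Definition smooth_consts (p : R) (X : normedModType R) : set R :=
  [set s : R | 0 < s /\ forall tau : R, 0 < tau -> rho_mod X tau <= s * tau `^ p].

Definition p_uniformly_smooth (p : R) (X : normedModType R) : Prop :=
  exists s, smooth_consts p X s.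

Definition s_p (p : R) (X : normedModType R) : R := inf (smooth_consts p X).

Definition separable (X : normedModType R) : Prop :=
  exists S : set X, countable S /\ closure S = setT.

Variables (d : measure_display) (Omega : measurableType d).

Definition simple_fun_in (X : normedModType R) (G : set (set Omega))
    (g : Omega -> X) : Prop :=
  finite_set (range g) /\ forall x : X, G (g @^-1` [set x]).

Definition strongly_measurable (X : normedModType R) (G : set (set Omega))
    (g : Omega -> X) : Prop :=
  exists s : nat -> Omega -> X, (forall n, simple_fun_in G (s n)) /\
    forall w, (fun n => s n w) @ \oo --> g w.

Definition filtration (F : nat -> set (set Omega)) : Prop :=
  [/\ forall j, sigma_algebra setT (F j),
      forall j, F j `<=` measurable &
      forall j, F j `<=` F j.+1].

Definition trivial_sigma (G : set (set Omega)) : Prop :=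
  forall A, G A -> A = set0 \/ A = setT.

Definition linear_functional (X : normedModType R) (phi : X -> R) : Prop :=
  forall (a : R) (x y : X), phi (a *: x + y) = a * phi x + phi y.

(* X-valued martingale: adapted, Bochner integrable, and
   E[f_{j+1} 1_A] = E[f_j 1_A] for A in F_j (tested against all continuous
   linear functionals, equivalent for Bochner integrals by Hahn-Banach) *)
Definition martingale (X : normedModType R) (P : probability Omega R)
    (F : nat -> set (set Omega)) (f : nat -> Omega -> X) : Prop :=
  [/\ forall j, strongly_measurable (F j) (f j),
      forall j, (\int[P]_w (`|f j w|)%:E < +oo)%E &
      forall j A, F j A -> forall phi : X -> R,
        linear_functional phi -> continuous phi ->
        (\int[P]_(w in A) (phi (f j.+1 w))%:E = \int[P]_(w in A) (phi (f j w))%:E)%E].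

(* martingale difference d_{i+1} = f_{i+1} - f_i *)
Definition mdiff (X : normedModType R) (f : nat -> Omega -> X) (i : nat)
    (w : Omega) : X := f i.+1 w - f i w.

Definition mdiff_vec (X : normedModType R) (f : nat -> Omega -> X) (j : nat)
    (w : Omega) : 'rV[X]_j.+1 := \row_(i < j.+1) mdiff f i w.

Definition mdiff_vec_neg (X : normedModType R) (f : nat -> Omega -> X) (j : nat)
    (w : Omega) : 'rV[X]_j.+1 :=
  \row_(i < j.+1) (if i == ord_max then - mdiff f i w else mdiff f i w).

Definition cond_symmetric (X : normedModType R) (P : probability Omega R)
    (f : nat -> Omega -> X) : Prop :=
  forall (j : nat) (phi : 'rV[X]_j.+1 -> R),
    continuous phi -> (exists M : R, forall v, `|phi v| <= M) ->
    (\int[P]_w (phi (mdiff_vec f j w))%:E = \int[P]_w (phi (mdiff_vec_neg f j w))%:E)%E.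

Definition Spp (X : normedModType R) (p : R) (f : nat -> Omega -> X) (n : nat)
    (w : Omega) : R := \sum_(i < n) `|mdiff f i w| `^ p.

End Defs.

(* Main.v *)
(** Put [M_n = cosh (lam |f_n - f_0|^(p/2)) * exp (- K lam^2 S_n / 2)] with
[S_n] the [p]-variation and [K = 20 s_p].  Writing
[cosh u + cosh v = 2 cosh ((u + v) / 2) cosh ((u - v) / 2)], concavity of
[t^(p/2)] and smoothness of the norm control the mean, subadditivity of
[t^(p/2)] controls the difference, and the decrease of [cosh t * exp (- t^2 / 2)]
on [t >= 0] turns both into [M_(n+1) (d_n) + M_(n+1) (- d_n) <= 2 M_n].  So [M] is
a positive supermartingale under conditional symmetry, and in particular
[M_n <= 2^n] pathwise.  Conditional symmetry is only available against bounded
continuous functions, so in Doob's maximal inequality the stopping time is replaced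
by a continuous cutoff; this costs a factor 2, which the constant 4 (instead of 2)
absorbs.  The theorem follows with [lam = r^(p/2) beta / K]. *)

Require Import Defs.
From mathcomp Require Import all_boot all_order all_algebra.
From mathcomp Require Import all_classical all_reals all_analysis.
From mathcomp Require Import measurable_realfun ring lra.
Import numFieldNormedType.Exports.
Import Order.TTheory GRing.Theory Num.Theory.
Local Open Scope classical_set_scope.
Local Open Scope ring_scope.
Set Implicit Arguments. Unset Strict Implicit. Unset Printing Implicit Defensive.

(** * Hyperbolic cosine and fractional power inequalities on the reals *)

Section RealInequalities.
Variable R : realType.
Implicit Types a b c e q s t x y : R.

Definition coshR t : R := (expR t + expR (- t)) / 2.

Lemma coshR0 : coshR 0 = 1.
Proof. by rewrite /coshR oppr0 expR0; lra. Qed.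

Lemma coshR_gt0 t : 0 < coshR t.
Proof. by rewrite divr_gt0// addr_gt0 ?expR_gt0. Qed.

Lemma coshR_ge_expR t : expR t / 2 <= coshR t.
Proof. by rewrite /coshR ler_pM2r// lerDl expR_ge0. Qed.

Lemma coshR_norm t : coshR `|t| = coshR t.
Proof. by case: (ger0P t) => // _; rewrite /coshR opprK addrC. Qed.

Lemma coshRD_half a b :
  coshR a + coshR b = 2 * (coshR ((a + b) / 2) * coshR ((a - b) / 2)).
Proof.
have -> : coshR a = coshR ((a + b) / 2 + (a - b) / 2) by congr coshR; lra.
have -> : coshR b = coshR ((a + b) / 2 - (a - b) / 2) by congr coshR; lra.
move: ((a + b) / 2) ((a - b) / 2) => u v.
by rewrite /coshR !opprD !opprK !expRD; field.
Qed.

(** The function [t cosh t - sinh t] vanishes at 0 and has derivative [t sinh t >= 0]. This fixes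
    the sign of the derivative of [cosh t * exp (- t^2 / 2)] in the next lemma. *)
Lemma sinh_le_mul_cosh t : 0 <= t ->
  expR t - expR (- t) <= t * (expR t + expR (- t)).
Proof.
move=> t0.
pose g (s : R) : R := (s - 1) * expR s + (s + 1) * expR (- s).
have dg (s : R) : is_derive s 1 g (s * (expR s - expR (- s))).
  by apply: is_derive_eq; rewrite /GRing.scale/=; ring.
have gc s : {for s, continuous g}.
  apply: differentiable_continuous; apply/derivable1_diffP.
  exact: (@ex_derive _ _ _ _ _ _ _ (dg s)).
suff : g 0 <= g t by rewrite /g oppr0 expR0; lra.
apply: (@ger0_derive1_ndecry _ _ 0) => //.
- move=> s; rewrite in_itv/= andbT => s0; rewrite derive1E derive_val.
  by rewrite mulr_ge0 ?ltW// subr_gt0 ltr_expR; lra.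
- exact: continuous_subspaceT.
Qed.

Lemma coshR_gauss_nincr c e : 0 <= c -> c <= e ->
  coshR e * expR (- (e ^+ 2 / 2)) <= coshR c * expR (- (c ^+ 2 / 2)).
Proof.
move=> c0 ce.
pose g (s : R) : R := (expR s + expR (- s)) * expR (- (s * s / 2)).
have dg (s : R) : is_derive s 1 g
   ((expR s - expR (- s) - s * (expR s + expR (- s))) * expR (- (s * s / 2))).
  by apply: is_derive_eq; rewrite /GRing.scale/=; field.
suff : g e <= g c by rewrite /g /coshR !expr2; lra.
apply: (@ler0_derive1_nincry _ _ 0) => //.
- move=> s; rewrite in_itv/= andbT => s0; rewrite derive1E derive_val.
  by rewrite pmulr_lle0 ?expR_gt0// subr_le0 sinh_le_mul_cosh// ltW.
- apply: continuous_subspaceT => s.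
  apply: differentiable_continuous; apply/derivable1_diffP.
  exact: (@ex_derive _ _ _ _ _ _ _ (dg s)).
Qed.

(** Converts additive control of squares into multiplicative control of [coshR]; both the mean and
    the difference in [coshR_norm_step] are bounded this way. *)
Lemma coshR_le_sq a b w : 0 <= b -> a ^+ 2 <= b ^+ 2 + w -> 0 <= w ->
  coshR a <= coshR b * expR (w / 2).
Proof.
move=> b0 abw w0; rewrite -(coshR_norm a).
have [ab|/ltW ba] := leP `|a| b.
  (* With [b = u + v] and [|a| = u - v], monotonicity is [cosh (u + v) - cosh (u - v) = 2 sinh u
     sinh v >= 0]. *)
  have h : coshR `|a| <= coshR b.
    have -> : coshR b = coshR ((b + `|a|) / 2 + (b - `|a|) / 2) by congr coshR; lra.
    have -> : coshR `|a| = coshR ((b + `|a|) / 2 - (b - `|a|) / 2) by congr coshR; lra.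
    have u0 : 0 <= (b + `|a|) / 2 by rewrite divr_ge0// addr_ge0.
    have v0 : 0 <= (b - `|a|) / 2 by rewrite divr_ge0// subr_ge0.
    move: u0 v0; move: ((b + `|a|) / 2) ((b - `|a|) / 2) => u v u0 v0.
    have hu : expR (- u) <= expR u by rewrite ler_expR; lra.
    have hv : expR (- v) <= expR v by rewrite ler_expR; lra.
    by rewrite /coshR !opprD !opprK !expRD; nra.
  apply: (le_trans h); rewrite ler_peMr ?(ltW (coshR_gt0 _))//.
  by rewrite -[leLHS]expR0 ler_expR; lra.
(* For [|a|] beyond [b], the Gaussian decrease gives [cosh a <= cosh b * exp ((a^2 - b^2) / 2)], and
   the exponent is at most [w / 2]. *)
have := coshR_gauss_nincr b0 ba.
rewrite real_normK ?num_real//.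
move=> h; rewrite -(@ler_pM2r _ (expR (- (a ^+ 2 / 2)))) ?expR_gt0//.
apply: (le_trans h); rewrite -[leRHS]mulrA -expRD ler_pM2l ?coshR_gt0// ler_expR; lra.
Qed.

(** The fractions [x / (x + y)] and [y / (x + y)] lie in [0, 1], where [t <= t^q], and they add up
    to 1. *)
Lemma powR_subadditive x y q : 0 <= x -> 0 <= y -> 0 < q -> q <= 1 ->
  (x + y) `^ q <= x `^ q + y `^ q.
Proof.
move=> x0 y0 q0 q1.
have [->|xn0] := eqVneq x 0; first by rewrite powR0 ?gt_eqF// !add0r.
have [->|yn0] := eqVneq y 0; first by rewrite powR0 ?gt_eqF// !addr0.
have xp : 0 < x by rewrite lt0r xn0.
have yp : 0 < y by rewrite lt0r yn0.
have xyp : 0 < x + y by rewrite addr_gt0.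
have h z : 0 < z -> z <= x + y -> (x + y) `^ q * (z / (x + y)) <= z `^ q.
  move=> z0 zxy; have -> : z `^ q = (x + y) `^ q * (z / (x + y)) `^ q.
    by rewrite -powRM ?ltW// ?divr_gt0// mulrCA divff ?mulr1// gt_eqF.
  rewrite ler_pM2l ?powR_gt0// ger1_powR// divr_gt0//=.
  by rewrite ler_pdivrMr// mul1r.
have := lerD (h x xp _) (h y yp _); rewrite -mulrDr -mulrDl divff ?gt_eqF// mulr1.
by apply; rewrite ?lerDl ?lerDr// ltW.
Qed.

Lemma powR_dist_le x y q : 0 <= x -> 0 <= y -> 0 < q -> q <= 1 ->
  `|x `^ q - y `^ q| <= `|x - y| `^ q.
Proof.
move=> + + q0 q1.
wlog yx : x y / y <= x.
  move=> H x0 y0; have [/H->//|/ltW/H] := leP y x.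
  by rewrite distrC (distrC x y); apply.
move=> x0 y0; have xyq : y `^ q <= x `^ q by apply: ge0_ler_powR; rewrite ?nnegrE// ltW.
rewrite ger0_norm ?subr_ge0// ger0_norm ?subr_ge0// lerBlDr.
have := @powR_subadditive (x - y) y q; rewrite subrK.
by apply; rewrite ?subr_ge0.
Qed.

(** Midpoint concavity of [t^q], derived from convexity of the inverse power [t^(1/q)] applied at
    [x^q] and [y^q]. *)
Lemma powR_mean_le x y q : 0 <= x -> 0 <= y -> 0 < q -> q <= 1 ->
  (x `^ q + y `^ q) / 2 <= ((x + y) / 2) `^ q.
Proof.
move=> x0 y0 q0 q1.
have qi : 1 <= q^-1 by rewrite invf_ge1.
have qK z : 0 <= z -> (z `^ q) `^ q^-1 = z.
  by move=> z0; rewrite -powRrM divff ?gt_eqF// powRr1.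
have -> : (x `^ q + y `^ q) / 2 = (((x `^ q + y `^ q) / 2) `^ q^-1) `^ q.
  by rewrite -powRrM mulVf ?gt_eqF// powRr1// divr_ge0// addr_ge0 ?powR_ge0.
apply: ge0_ler_powR; rewrite ?nnegrE ?powR_ge0 ?(ltW q0) ?divr_ge0 ?addr_ge0//.
have h0 : 0 <= 2^-1 :> R by rewrite invr_ge0.
have h1 : 2^-1 <= 1 :> R by rewrite invf_le1// ler1n.
have := @convex_powR R q^-1 qi (Itv01 h0 h1) (x `^ q) (y `^ q).
rewrite !inE/= !in_itv/= !andbT !powR_ge0 => /(_ isT isT).
rewrite convRE [X in X `^ _ <= _]convRE/= !qK// /unstable.onem.
have -> : 1 - 2^-1 = 2^-1 :> R by lra.
by rewrite -!mulrDr !(mulrC 2^-1).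
Qed.

End RealInequalities.

(** * Uniform smoothness and the two-point inequality for the norm *)

Section SmoothNorm.
Variables (R : realType) (X : normedModType R).
Implicit Types (x y : X) (p s tau lam : R).

Lemma modulus_le_rho_mod tau x y : 0 <= tau -> `|x| = 1 -> `|y| = 1 ->
  (`|x + tau *: y| + `|x - tau *: y|) / 2 - 1 <= rho_mod X tau.
Proof.
move=> tau0 x1 y1; apply: ub_le_sup; last by exists x, y.
(* The triangle inequality bounds the set by [tau], so [sup] is a true supremum and not the default
   value for unbounded sets. *)
exists tau => _ [u [v [u1 [v1 ->]]]].
have := ler_normD u (tau *: v); have := ler_normB u (tau *: v).
by rewrite normrZ u1 v1 ger0_norm//; lra.
Qed.

(** Testing the modulus at [tau = 2] with both vectors equal to one unit vector gives
    [(3 + 1) / 2 - 1 = 1 <= s * 2^p <= 4 s]. The lower bound later absorbs pure numbers into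
    multiples of [s]. *)
Lemma smooth_consts_ge p s : p <= 2 -> (exists x, x != 0) ->
  smooth_consts p X s -> 1 / 4 <= s.
Proof.
move=> p2 [x x0] [s0 hs].
have [u u1] : exists u : X, `|u| = 1.
  exists (`|x|^-1 *: x); by rewrite normrZ normfV normr_id mulVf// normr_eq0.
have := le_trans (@modulus_le_rho_mod 2 _ _ _ u1 u1) (hs 2 _).
have -> : u + 2 *: u = 3%:R *: u.
  by rewrite -{1}(scale1r u) -scalerDl; congr (_ *: _); lra.
have -> : u - 2 *: u = (-1) *: u.
  by rewrite -{1}(scale1r u) -scalerBl; congr (_ *: _); lra.
rewrite !normrZ u1 normrN1 ger0_norm// => /(_ (ler0n _ _) (ltr0n _ _)) h.
have : (2 : R) `^ p <= 4.
  have := ler_powR (ler1n R 2) p2; rewrite powR_mulrn// => /le_trans; apply; lra.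
by nra.
Qed.

(** The infimum is attained: every constraint [rho_mod X tau / tau^p <= s] is closed in [s], and
    positivity survives thanks to the bound 1/4. *)
Lemma s_p_smooth_consts p : p <= 2 -> (exists x, x != 0) ->
  p_uniformly_smooth p X -> smooth_consts p X (s_p p X).
Proof.
move=> p2 X0 [s hs].
have ge14 : 1 / 4 <= s_p p X.
  by apply: lb_le_inf; [exists s | move=> t /(smooth_consts_ge p2 X0)].
split; first lra.
move=> tau tau0; rewrite -ler_pdivrMr ?powR_gt0//.
apply: lb_le_inf; first by exists s.
by move=> t [_ /(_ _ tau0)]; rewrite ler_pdivrMr ?powR_gt0.
Qed.

Lemma mean_norm_powR_le p s x y : 1 < p <= 2 -> 1 / 4 <= s ->
  smooth_consts p X s ->
  ((`|x + y| + `|x - y|) / 2) `^ p <= `|x| `^ p + 16 * s * `|y| `^ p.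
Proof.
move=> /andP[p1 p2] s4 [s0 hs].
have [m mdef] : {m | (`|x + y| + `|x - y|) / 2 = m} by eexists.
rewrite mdef.
have p0 : 0 <= p by lra.
have mle : m <= `|x| + `|y|.
  by have := ler_normD x y; have := ler_normB x y; rewrite -mdef; lra.
have xm : `|x| <= m.
  have := ler_normD (x + y) (x - y).
  have -> : x + y + (x - y) = 2 *: x by rewrite addrACA subrr addr0 scaler_nat mulr2n.
  by rewrite normrZ ger0_norm// -mdef; lra.
have m0 : 0 <= m := le_trans (normr_ge0 x) xm.
(* When [|x| < |y|] smoothness plays no part: [m <= 2 |y|] gives [m^p <= 4 |y|^p <= 16 s |y|^p]
   because [s >= 1 / 4]. This case dictates the 16. *)
have [xy|yx] := ltP `|x| `|y|.
  have : m `^ p <= (2 * `|y|) `^ p by apply: ge0_ler_powR; rewrite ?nnegrE//; lra.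
  rewrite powRM//.
  have : (2 : R) `^ p <= 4.
    have := ler_powR (ler1n R 2) p2; rewrite powR_mulrn// => /le_trans; apply; lra.
  have := powR_ge0 `|y| p; have := powR_ge0 `|x| p.
  move: (2 `^ p) (`|x| `^ p) (`|y| `^ p) (m `^ p) => A B C M B0 C0 A4 MAC.
  have : A * C <= 4 * C by rewrite ler_wpM2r.
  have : 4 * C <= 16 * s * C by rewrite ler_wpM2r//; lra.
  by lra.
have [y0|yn0] := eqVneq y 0.
  have -> : m = `|x| by rewrite -mdef y0 subr0 addr0; lra.
  by rewrite lerDl !mulr_ge0 ?powR_ge0 ?ltW.
have yp : 0 < `|y| by rewrite normr_gt0.
have xp : 0 < `|x| by exact: lt_le_trans yx.
(* Rescaling by [|x|] reduces to unit vectors: [u - 1], with [u = m / |x|], is a value of the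
   modulus at [t <= 1]. *)
pose t := `|y| / `|x|.
have t0 : 0 < t by rewrite divr_gt0.
have mE : m = `|x| * (m / `|x|) by rewrite mulrCA divff ?gt_eqF// mulr1.
have yE : `|y| = `|x| * t by rewrite /t mulrCA divff ?gt_eqF// mulr1.
set u := m / `|x| in mE.
have u1 : 1 <= u by rewrite ler_pdivlMr// mul1r.
have u2 : u <= 2 by rewrite ler_pdivrMr//; lra.
have ut : u - 1 <= s * t `^ p.
  apply: le_trans (hs _ t0).
  have xu : `| `|x|^-1 *: x| = 1 by rewrite normrZ normfV normr_id mulVf// gt_eqF.
  have yu : `| `|y|^-1 *: y| = 1 by rewrite normrZ normfV normr_id mulVf// gt_eqF.
  apply: le_trans (modulus_le_rho_mod (ltW t0) xu yu).
  have -> : t *: (`|y|^-1 *: y) = `|x|^-1 *: y.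
    by rewrite scalerA /t mulrAC divff ?gt_eqF// mul1r.
  rewrite -scalerDr -scalerBr !normrZ normfV normr_id /u -mdef.
  by rewrite -mulrDr mulrAC (mulrC `|x|^-1).
have up : u `^ p <= u ^+ 2 by rewrite -powR_mulrn ?ler_powR//; lra.
rewrite mE yE; clearbody u t; rewrite powRM ?(le_trans ler01 u1)// powRM ?(ltW t0)//.
have : 0 <= t `^ p by exact: powR_ge0.
have : 0 < `|x| `^ p by exact: powR_gt0.
move: ut up; move: (`|x| `^ p) (t `^ p) (u `^ p) => A B C h1 h2 A0 B0.
(* Here [u^p <= u^2 = 1 + (u - 1) (u + 1)] with [u + 1 <= 3] and [u - 1 <= s t^p]. *)
have CB : C <= 1 + 16 * s * B by nra.
have -> : A + 16 * s * (A * B) = A * (1 + 16 * s * B) by ring.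
by rewrite ler_pM2l.
Qed.

(** The constant is [20 s = 16 s + 4 s]: the mean factor costs [16 s], and the difference factor
    costs 1, which is at most [4 s]. *)
Lemma coshR_norm_step p s lam x y : 1 < p <= 2 -> 1 / 4 <= s ->
  smooth_consts p X s -> 0 <= lam ->
  coshR (lam * `|x + y| `^ (p / 2)) + coshR (lam * `|x - y| `^ (p / 2)) <=
  2 * (coshR (lam * `|x| `^ (p / 2)) *
       expR (20 * s * lam ^+ 2 / 2 * `|y| `^ p)).
Proof.
move=> p12 s4 hs lam0; have /andP[p1 p2] := p12.
have q0 : 0 < p / 2 by lra.
have q1 : p / 2 <= 1 by lra.
have sqr (z : R) : (z `^ (p / 2)) ^+ 2 = z `^ p.
  by rewrite -powR_mulrn ?powR_ge0// -powRrM divfK.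
set v := `|y| `^ p; have v0 : 0 <= v by exact: powR_ge0.
set a := lam * `|x + y| `^ _; set b := lam * `|x - y| `^ _.
have mean : coshR ((a + b) / 2) <=
    coshR (lam * `|x| `^ (p / 2)) * expR (16 * s * lam ^+ 2 * v / 2).
  apply: coshR_le_sq; first by rewrite mulr_ge0 ?powR_ge0.
    rewrite [X in _ <= X + _]exprMn sqr.
    have -> : (a + b) / 2 = lam * ((`|x + y| `^ (p / 2) + `|x - y| `^ (p / 2)) / 2).
      by rewrite /a /b; lra.
    rewrite exprMn -subr_ge0.
    have -> : lam ^+ 2 * `|x| `^ p + 16 * s * lam ^+ 2 * v =
      lam ^+ 2 * (`|x| `^ p + 16 * s * v) by ring.
    rewrite -mulrBr mulr_ge0 ?sqr_ge0// subr_ge0.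
    apply: le_trans (mean_norm_powR_le x y p12 s4 hs).
    rewrite -sqr ler_sqr ?nnegrE ?powR_ge0 ?divr_ge0 ?addr_ge0 ?powR_ge0//.
    exact: powR_mean_le.
  by rewrite !mulr_ge0// ?sqr_ge0//; lra.
have diff : coshR ((a - b) / 2) <= expR (lam ^+ 2 * v / 2).
  have := @coshR_le_sq _ ((a - b) / 2) 0 (lam ^+ 2 * v) (lexx _).
  rewrite coshR0 mul1r expr0n/= add0r; apply; last by rewrite mulr_ge0 ?sqr_ge0.
  have -> : (a - b) / 2 = lam * ((`|x + y| `^ (p / 2) - `|x - y| `^ (p / 2)) / 2).
    by rewrite /a /b; lra.
  rewrite exprMn ler_wpM2l ?sqr_ge0// -real_normK ?num_real//.
  rewrite /v -sqr ler_sqr ?nnegrE ?powR_ge0// normrM (ger0_norm (x := 2^-1))//.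
  rewrite ler_pdivrMr//.
  apply: (le_trans (powR_dist_le _ _ q0 q1)) => //.
  (* Subadditivity turns this into a gap of at most [2^(p/2) |y|^(p/2) <= 2 |y|^(p/2)] between the
     powers; halving leaves [|y|^(p/2)]. *)
  have dle : `| `|x + y| - `|x - y| | <= 2 * `|y|.
    apply: (le_trans (ler_dist_dist _ _)).
    have -> : x + y - (x - y) = 2 *: y.
      by rewrite opprB addrC addrA subrK scaler_nat mulr2n.
    by rewrite normrZ ger0_norm.
  have : `| `|x + y| - `|x - y| | `^ (p / 2) <= (2 * `|y|) `^ (p / 2).
    by apply: ge0_ler_powR; rewrite ?nnegrE ?(ltW q0) ?mulr_ge0.
  move=> /le_trans; apply; rewrite powRM// mulrC ler_wpM2l ?powR_ge0//.
  by rewrite ler1_powR// ler1n.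
rewrite coshRD_half ler_pM2l//.
apply: (le_trans (ler_pM (ltW (coshR_gt0 _)) (ltW (coshR_gt0 _)) mean diff)).
rewrite -[leLHS]mulrA -expRD ler_pM2l ?coshR_gt0// ler_expR.
have : 0 <= lam ^+ 2 * v by rewrite mulr_ge0 ?sqr_ge0.
have -> : 16 * s * lam ^+ 2 * v / 2 = 8 * s * (lam ^+ 2 * v) by lra.
have -> : 20 * s * lam ^+ 2 / 2 * v = 10 * s * (lam ^+ 2 * v) by lra.
by move: (lam ^+ 2 * v) => w w0; nra.
Qed.

End SmoothNorm.

(** * The exponential supermartingale and its continuously stopped version, pathwise *)

Section StoppedProcess.
Variables (R : realType) (X : normedModType R).
Variables (p lam K a : R).
Hypotheses (p12 : 1 < p <= 2) (a0 : 0 < a).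
Hypothesis step : forall x y : X,
  coshR (lam * `|x + y| `^ (p / 2)) + coshR (lam * `|x - y| `^ (p / 2)) <=
  2 * (coshR (lam * `|x| `^ (p / 2)) * expR (K * lam ^+ 2 / 2 * `|y| `^ p)).
Implicit Types (d : nat -> X) (n : nat) (t : R).

(** These quantities take a deterministic difference sequence, so that a sample path, its reflection
    in the last difference and a row vector of differences can all be substituted. *)
Definition psum n d : X := \sum_(i < n) d i.

Definition pvar n d : R := \sum_(i < n) `|d i| `^ p.

Definition expmart n d : R :=
  coshR (lam * `|psum n d| `^ (p / 2)) * expR (- (K * lam ^+ 2 / 2 * pvar n d)).

(* [2 - t / a] clamped to the interval [[0, 1]] *)
Definition cutoff t : R := (1 + `|2 - t / a| - `|1 - t / a|) / 2.

Definition weight n d : R := \prod_(i < n) cutoff (expmart i d).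

(* Continuous substitute for [expmart] stopped on reaching [a]: once [expmart]
   has exceeded [2 * a] the weight vanishes and the value is frozen at [a]. *)
Definition stopped n d : R := a * (1 - weight n d) + weight n d * expmart n d.

Lemma cutoff_itv t : 0 <= cutoff t <= 1.
Proof.
rewrite /cutoff; move: (t / a) => u.
by case: (ger0P (2 - u)) => ?; case: (ger0P (1 - u)) => ?; lra.
Qed.

Lemma cutoff1 t : t <= a -> cutoff t = 1.
Proof.
move=> ta; have : t / a <= 1 by rewrite ler_pdivrMr// mul1r.
by rewrite /cutoff; move: (t / a) => u u1; rewrite !ger0_norm; lra.
Qed.

Lemma cutoff0 t : 2 * a <= t -> cutoff t = 0.
Proof.
move=> ta; have : 2 <= t / a by rewrite ler_pdivlMr.
by rewrite /cutoff; move: (t / a) => u u1; rewrite !ler0_norm; lra.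
Qed.

Lemma weight_itv n d : 0 <= weight n d <= 1.
Proof.
rewrite /weight prodr_ile1 ?andbT => [|i _]; last exact: cutoff_itv.
by rewrite prodr_ge0// => i _; case/andP: (cutoff_itv (expmart i d)).
Qed.

Lemma expmart_gt0 n d : 0 < expmart n d.
Proof. by rewrite mulr_gt0 ?coshR_gt0 ?expR_gt0. Qed.

Lemma eq_expmart n d d' : (forall i, (i < n)%N -> d i = d' i) ->
  expmart n d = expmart n d'.
Proof.
move=> dd'; rewrite /expmart.
have -> : psum n d = psum n d' by apply: eq_bigr => i _; rewrite dd'.
by have -> : pvar n d = pvar n d' by apply: eq_bigr => i _; rewrite dd'.
Qed.

(** Predictability: the last factor of [weight n.+1] is the cutoff of [expmart n], which reads only
    differences below [n]. Reflecting [d n] therefore leaves the weight unchanged. *)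
Lemma eq_weight n d d' : (forall i, (i < n)%N -> d i = d' i) ->
  weight n.+1 d = weight n.+1 d'.
Proof.
move=> dd'; apply: eq_bigr => i _; congr (cutoff _); apply: (@eq_expmart i d d') => j ji.
by apply: dd'; apply: (leq_trans ji); rewrite -ltnS.
Qed.

Lemma eq_stopped n d d' : (forall i, (i < n)%N -> d i = d' i) ->
  stopped n d = stopped n d'.
Proof.
move=> dd'; rewrite /stopped (eq_expmart dd').
suff -> : weight n d = weight n d' by [].
case: n dd' => [_|n dd']; first by rewrite /weight !big_ord0.
by apply: (@eq_weight n d d') => i /ltnW; exact: dd'.
Qed.

(** Both paths have the same [p]-variation, so they share one exponential factor, and its new part
    cancels the exponential in [step]. *)
Lemma expmart_step n d d' : (forall i, (i < n)%N -> d' i = d i) ->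
  d' n = - d n -> expmart n.+1 d + expmart n.+1 d' <= 2 * expmart n d.
Proof.
move=> dd' d'n; rewrite /expmart.
have -> : psum n.+1 d = psum n d + d n by rewrite /psum big_ord_recr.
have -> : psum n.+1 d' = psum n d - d n.
  rewrite /psum big_ord_recr/= d'n; congr (_ + _).
  by apply: eq_bigr => i _; rewrite dd'.
have -> : pvar n.+1 d = pvar n d + `|d n| `^ p by rewrite /pvar big_ord_recr.
have -> : pvar n.+1 d' = pvar n d + `|d n| `^ p.
  rewrite /pvar big_ord_recr/= d'n normrN; congr (_ + _).
  by apply: eq_bigr => i _; rewrite dd'.
move: (psum n d) (d n) (pvar n d) => x y v.
rewrite mulrDr opprD expRD -mulrDl.
have := step x y.
move: (coshR _ + coshR _) => A; move: (coshR _) => B AB.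
have := expR_gt0 (- (K * lam ^+ 2 / 2 * v)).
have := expR_gt0 (- (K * lam ^+ 2 / 2 * `|y| `^ p)).
have : expR (- (K * lam ^+ 2 / 2 * `|y| `^ p)) * expR (K * lam ^+ 2 / 2 * `|y| `^ p) = 1.
  by rewrite -expRD addNr expR0.
move: AB; move: (expR (K * _ / _ * _)) => E.
move: (expR (- (K * lam ^+ 2 / 2 * `|y| `^ p))) => E2.
move: (expR _) => E1 AB EE E20 E10.
have -> : 2 * (B * E1) = 2 * (B * E) * (E1 * E2) by rewrite -[B * E1]mulr1 -EE; ring.
by rewrite ler_wpM2r// ltW// mulr_gt0.
Qed.

(** Dropping the positive term of the reflected path in [expmart_step] shows that one step at most
    doubles the value. The bound makes [stopped] a bounded test function. *)
Lemma expmart_le n d : expmart n d <= 2 ^+ n.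
Proof.
elim: n d => [|n IH] d.
  rewrite /expmart /psum /pvar !big_ord0 normr0 powR0; last by case/andP: p12; lra.
  by rewrite !mulr0 coshR0 oppr0 expR0 mulr1 expr0.
pose d' i := if i == n then - d n else d i.
have d'd i : (i < n)%N -> d' i = d i by rewrite /d'; case: eqP => // ->; rewrite ltnn.
have d'n : d' n = - d n by rewrite /d' eqxx.
have := expmart_step d'd d'n; rewrite exprS.
have := expmart_gt0 n.+1 d'; have := IH d.
move: (expmart n d) (expmart n.+1 d) (expmart n.+1 d') (2 ^+ n) => A B C E; lra.
Qed.

Lemma stopped0 d : stopped 0 d = 1.
Proof.
rewrite /stopped /weight big_ord0 subrr mulr0 add0r mul1r.
rewrite /expmart /psum /pvar !big_ord0 normr0 powR0; last by case/andP: p12; lra.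
by rewrite !mulr0 coshR0 oppr0 expR0 mulr1.
Qed.

Lemma stopped_ge0 n d : 0 <= stopped n d.
Proof.
have /andP[w0 w1] := weight_itv n d.
by rewrite addr_ge0 ?mulr_ge0 ?subr_ge0 ?(ltW a0) ?(ltW (expmart_gt0 _ _)).
Qed.

Lemma stopped_le n d : stopped n d <= a + 2 ^+ n.
Proof.
have /andP[w0 w1] := weight_itv n d.
apply: lerD; first by rewrite ger_pMr// gerBl.
apply: le_trans (expmart_le n d).
by rewrite ger_pMl ?expmart_gt0.
Qed.

Lemma stopped_step n d d' : (forall i, (i < n)%N -> d' i = d i) ->
  d' n = - d n -> stopped n.+1 d + stopped n.+1 d' <= 2 * stopped n d.
Proof.
move=> dd' d'n; have := expmart_step dd' d'n.
rewrite /stopped (eq_weight dd') /weight big_ord_recr/= -/(weight n d).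
have /andP[] := weight_itv n d; have /andP[] := cutoff_itv (expmart n d).
have := @cutoff1 (expmart n d).
move: (weight n d) (expmart n.+1 d) (expmart n.+1 d') (expmart n d) (cutoff (expmart n d)).
move=> w A B M k k1 k0 kle1 w0 w1 ABM.
have wkAB : w * k * (A + B) <= w * k * (2 * M) by rewrite ler_wpM2l ?mulr_ge0.
(* Twice this quantity is the slack left after using [expmart_step]. It is nonnegative since the
   cutoff [k] drops below 1 only when [M > a]. *)
have : 0 <= w * ((1 - k) * (M - a)).
  rewrite mulr_ge0//; have [/k1->|/ltW aM] := leP M a; first by rewrite subrr mul0r.
  by rewrite mulr_ge0 ?subr_ge0.
by move: wkAB; rewrite !mulrBr !mulrDr !mulrBl !mulr1 !mul1r; nra.
Qed.

Lemma stopped_hit n m d : (m < n)%N -> 2 * a <= expmart m d -> stopped n d = a.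
Proof.
move=> mn h; rewrite /stopped.
have -> : weight n d = 0; last by rewrite subr0 mulr1 mul0r addr0.
by rewrite /weight (bigD1 (Ordinal mn))//= cutoff0 ?mul0r.
Qed.

End StoppedProcess.

(** * Continuity of the stopped process in the differences *)

Section StoppedProcessContinuity.
Variables (R : realType) (X : normedModType R).

Lemma norm_powR_continuous (q : R) : 0 < q -> q <= 1 ->
  continuous (fun x : X => `|x| `^ q).
Proof.
move=> q0 q1 x; apply/cvgrPdist_lt => e e0.
have d0 : 0 < e `^ q^-1 by exact: powR_gt0.
near=> y.
apply: (le_lt_trans (powR_dist_le _ _ q0 q1)) => //.
have : `|x - y| < e `^ q^-1.
  by near: y; exact: (@cvgr_dist_lt _ _ _ _ _ id x (@cvg_id _ _) _ d0).
move=> xy.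
have -> : e = (e `^ q^-1) `^ q by rewrite -powRrM mulVf ?gt_eqF// powRr1// ltW.
apply: gt0_ltr_powR; rewrite ?nnegrE//; first exact: ltW.
exact: le_lt_trans (ler_dist_dist _ _) xy.
Unshelve. all: by end_near. Qed.

Variables (p lam K a : R).
Hypothesis p12 : 1 < p <= 2.

Variables (T : topologicalType) (D : T -> nat -> X).
Hypothesis cD : forall i, continuous (D ^~ i).

(** Since [p > 1], the power is written as the square of the [p/2] power, whose exponent is at most
    1. *)
Lemma norm_powR_p_continuous : continuous (fun x : X => `|x| `^ p).
Proof.
have /andP[p1 p2] := p12.
have -> : (fun x : X => `|x| `^ p) = (fun x => `|x| `^ (p / 2) * `|x| `^ (p / 2)).
  by apply/funext => x; rewrite -expr2 -powR_mulrn ?powR_ge0// -powRrM divfK.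
by move=> x; apply: cvgM; apply: norm_powR_continuous; lra.
Qed.

Lemma psum_continuous n : continuous (fun v => psum n (D v)).
Proof.
elim: n => [|n IH].
  rewrite /psum; under eq_fun do rewrite big_ord0; exact: cst_continuous.
rewrite /psum; under eq_fun do rewrite big_ord_recr.
by move=> v; apply: cvgD; [exact: IH | exact: cD].
Qed.

Lemma pvar_continuous n : continuous (fun v => pvar p n (D v)).
Proof.
elim: n => [|n IH].
  rewrite /pvar; under eq_fun do rewrite big_ord0; exact: cst_continuous.
rewrite /pvar; under eq_fun do rewrite big_ord_recr.
move=> v; apply: cvgD; first exact: IH.
exact: (cvg_comp _ _ (@cD n v) (@norm_powR_p_continuous _)).
Qed.

Lemma coshR_continuous : continuous (@coshR R).
Proof.
move=> t; apply: cvgMl; apply: cvgD; first exact: continuous_expR.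
apply: continuous_comp; first exact: opp_continuous.
exact: continuous_expR.
Qed.

Lemma expmart_continuous n : continuous (fun v => expmart p lam K n (D v)).
Proof.
have /andP[p1 p2] := p12.
have cn : continuous (fun x : X => `|x| `^ (p / 2)).
  by apply: norm_powR_continuous; lra.
move=> v; apply: cvgM.
  apply: (@cvg_comp _ _ _ _ (@coshR R) _ _ _ _ (@coshR_continuous _)).
  apply: cvgMr; exact: (cvg_comp _ _ (@psum_continuous n v) (@cn _)).
apply: (@cvg_comp _ _ _ _ (@expR R) _ _ _ _ (@continuous_expR _ _)).
by apply: cvgN; apply: cvgMr; exact: pvar_continuous.
Qed.

Lemma cutoff_continuous : continuous (@cutoff R a).
Proof.
have c (k : R) : continuous (fun t : R => `|k - t / a|).
  move=> t; apply: cvg_norm; apply: cvgB; first exact: cvg_cst.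
  by apply: cvgMl; exact: cvg_id.
move=> t; apply: cvgMl; apply: cvgB; last exact: c.
by apply: cvgD; [exact: cvg_cst | exact: c].
Qed.

Lemma weight_continuous n : continuous (fun v => weight p lam K a n (D v)).
Proof.
elim: n => [|n IH].
  rewrite /weight; under eq_fun do rewrite big_ord0; exact: cst_continuous.
rewrite /weight; under eq_fun do rewrite big_ord_recr.
move=> v; apply: cvgM; first exact: IH.
exact: (cvg_comp _ _ (@expmart_continuous n v) (@cutoff_continuous _)).
Qed.

(** With [T] a space of row vectors and [D] reading coordinates, this and [stopped_le] make
    [stopped] admissible in [cond_symmetric]. *)
Lemma stopped_continuous n : continuous (fun v => stopped p lam K a n (D v)).
Proof.
move=> v; apply: cvgD.
  apply: cvgMr; apply: cvgB; [exact: cvg_cst | exact: weight_continuous].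
by apply: cvgM; [exact: weight_continuous | exact: expmart_continuous].
Qed.

End StoppedProcessContinuity.

(** * Measurability of the process via simple approximations *)

Section StrongMeasurability.
Variables (R : realType) (X : normedModType R).
Variables (dsp : measure_display) (Omega : measurableType dsp).
Implicit Types g h : Omega -> X.

(** A preimage under [h \o g] is a finite union of fibres of [g], whatever [h] is. *)
Lemma simple_fun_measurable_comp g (h : X -> R) :
  simple_fun_in measurable g -> measurable_fun setT (h \o g).
Proof.
move=> [fing mg] _ Y mY; rewrite setTI.
have -> : (h \o g) @^-1` Y = \bigcup_(x in range g `&` h @^-1` Y) (g @^-1` [set x]).
  apply/seteqP; split => [w Yw|w [x [_ Yx] /= gx]]; last by rewrite /preimage/= gx.
  by exists (g w) => //; split => //; exists w.
by apply: fin_bigcup_measurable => [|x _]; [exact: finite_setIl | exact: mg].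
Qed.

Lemma simple_fun_inD g h : simple_fun_in measurable g ->
  simple_fun_in measurable h -> simple_fun_in measurable (g \+ h).
Proof.
move=> [fing mg] [finh mh]; split; first exact: (finite_image11 +%R fing finh).
move=> x.
have -> : (g \+ h) @^-1` [set x] =
    \bigcup_(y in range g) (g @^-1` [set y] `&` h @^-1` [set x - y]).
  apply/seteqP; split => [w /= ghw|w [y _ [/= gy hy]]]; last by rewrite /= hy gy subrKC.
  by exists (g w); [exists w | split => //=; rewrite -ghw addrC addKr].
by apply: fin_bigcup_measurable => // y _; exact: measurableI.
Qed.

Lemma simple_fun_inN g : simple_fun_in measurable g ->
  simple_fun_in measurable (fun w => - g w).
Proof.
move=> [fing mg]; split.
  by rewrite -(image_comp g); exact: finite_image.
move=> x; rewrite (_ : _ @^-1` _ = g @^-1` [set - x]); first exact: mg.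
by apply/seteqP; split => w /= gx; [rewrite -gx opprK | rewrite gx opprK].
Qed.

Lemma strongly_measurableD g h : strongly_measurable measurable g ->
  strongly_measurable measurable h -> strongly_measurable measurable (g \+ h).
Proof.
move=> [s [ms sg]] [t [mt th]]; exists (fun n => s n \+ t n); split.
  by move=> n; exact: simple_fun_inD.
by move=> w; apply: cvgD.
Qed.

Lemma strongly_measurableN g : strongly_measurable measurable g ->
  strongly_measurable measurable (fun w => - g w).
Proof.
move=> [s [ms sg]]; exists (fun n w => - s n w); split.
  by move=> n; exact: simple_fun_inN.
by move=> w; apply: cvgN.
Qed.

Lemma strongly_measurable0 :
  strongly_measurable measurable (fun _ : Omega => 0 : X).
Proof.
exists (fun _ _ => 0); split => [n|w]; last exact: cvg_cst.
split; first by apply: (sub_finite_set _ (finite_set1 0)) => _ [w _ <-].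
move=> x; have [->|x0] := eqVneq x 0.
  by rewrite (_ : _ @^-1` _ = setT)//; apply/seteqP; split.
rewrite (_ : _ @^-1` _ = set0)//; apply/seteqP; split => // w /= /esym/eqP.
by rewrite (negbTE x0).
Qed.

Lemma strongly_measurable_norm g : strongly_measurable measurable g ->
  measurable_fun setT (fun w => `|g w|).
Proof.
move=> [s [ms sg]].
apply: (@measurable_fun_cvg _ _ _ _ (fun n w => `|s n w|)).
  by move=> n; exact: (simple_fun_measurable_comp Num.norm (ms n)).
by move=> w _; apply: cvg_norm.
Qed.

Variable D : Omega -> nat -> X.
Hypothesis mD : forall i, strongly_measurable measurable (D ^~ i).

Lemma psum_strongly_measurable n :
  strongly_measurable measurable (fun w => psum n (D w)).
Proof.
elim: n => [|n IH].
  by rewrite /psum; under eq_fun do rewrite big_ord0; exact: strongly_measurable0.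
rewrite /psum; under eq_fun do rewrite big_ord_recr.
exact: (strongly_measurableD IH (mD n)).
Qed.

Variables p lam K a : R.

Lemma pvar_measurable n : measurable_fun setT (fun w => pvar p n (D w)).
Proof.
apply: measurable_sum => i.
apply: (measurableT_comp (measurable_powR _)).
exact: (strongly_measurable_norm (mD i)).
Qed.

Lemma coshR_measurable : measurable_fun setT (@coshR R).
Proof. by apply: continuous_measurable_fun; exact: coshR_continuous. Qed.

Lemma expmart_measurable n :
  measurable_fun setT (fun w => expmart p lam K n (D w)).
Proof.
apply: measurable_funM.
  apply: (measurableT_comp coshR_measurable); apply: measurable_funM => //.
  apply: (measurableT_comp (measurable_powR _)).
  exact: (strongly_measurable_norm (psum_strongly_measurable n)).
apply: measurableT_comp => //; apply: measurableT_comp => //.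
by apply: measurable_funM => //; exact: pvar_measurable.
Qed.

Lemma weight_measurable n :
  measurable_fun setT (fun w => weight p lam K a n (D w)).
Proof.
apply: measurable_prod => i _.
apply: (measurableT_comp _ (expmart_measurable i)).
by apply: continuous_measurable_fun; exact: cutoff_continuous.
Qed.

Lemma stopped_measurable n :
  measurable_fun setT (fun w => stopped p lam K a n (D w)).
Proof.
apply: measurable_funD.
  apply: measurable_funM => //; apply: measurable_funB => //.
  exact: weight_measurable.
by apply: measurable_funM; [exact: weight_measurable | exact: expmart_measurable].
Qed.

End StrongMeasurability.

(** * Supermartingale property in expectation and the maximal inequality *)

Section MaximalInequality.
Variables (R : realType) (X : normedModType R).
Variables (dsp : measure_display) (Omega : measurableType dsp).
Variables (P : probability Omega R) (f : nat -> Omega -> X).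

Lemma row_coord_continuous n (i : 'I_n) :
  continuous (fun v : 'rV[X]_n => v ord0 i).
Proof.
move=> v A /= /(nbhs_ballP (v ord0 i)) [e e0 eA].
by apply/nbhs_ballP; exists e => //= u [_ uv]; exact/eA/uv.
Qed.

Lemma psum_mdiff n w : psum n (fun i => mdiff f i w) = f n w - f 0%N w.
Proof.
rewrite /psum; elim: n => [|n IH]; first by rewrite big_ord0 subrr.
by rewrite big_ord_recr/= IH /mdiff addrC addrA subrK.
Qed.

Hypothesis mf : forall j, strongly_measurable measurable (f j).
Hypothesis csf : cond_symmetric P f.

Lemma mdiff_strongly_measurable i : strongly_measurable measurable (mdiff f i).
Proof. exact: (strongly_measurableD (mf i.+1) (strongly_measurableN (mf i))). Qed.

Variables (p lam K a : R).
Hypotheses (p12 : 1 < p <= 2) (a0 : 0 < a).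
Hypothesis step : forall x y : X,
  coshR (lam * `|x + y| `^ (p / 2)) + coshR (lam * `|x - y| `^ (p / 2)) <=
  2 * (coshR (lam * `|x| `^ (p / 2)) * expR (K * lam ^+ 2 / 2 * `|y| `^ p)).

Let S n (d : nat -> X) := stopped p lam K a n d.
Let D w i := mdiff f i w.

(** By conditional symmetry the path [D] and its reflection [D'] give the same expectation at time
    [n.+1], so integrating [stopped_step] yields twice the claim. *)
Lemma expectation_stopped_step n :
  (\int[P]_w (S n.+1 (D w))%:E <= \int[P]_w (S n (D w))%:E)%E.
Proof.
pose D' w i := if i == n then - D w i else D w i.
have mD i : strongly_measurable measurable (D ^~ i) by exact: mdiff_strongly_measurable.
have mD' i : strongly_measurable measurable (D' ^~ i).
  by rewrite /D'; case: eqP => _; [exact: strongly_measurableN | exact: mD].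
have S0 k d : 0 <= S k d by exact: stopped_ge0.
have mS k : measurable_fun setT (fun w => (S k (D w))%:E).
  by apply/measurable_EFinP; exact: stopped_measurable.
have mS' k : measurable_fun setT (fun w => (S k (D' w))%:E).
  by apply/measurable_EFinP; exact: stopped_measurable.
(* [inord] returns a default index beyond [n], but [S n.+1] reads only indices up to [n]. *)
pose phi (v : 'rV[X]_n.+1) := S n.+1 (fun i => v ord0 (inord i)).
have phic : continuous phi.
  by apply: stopped_continuous => // i; exact: row_coord_continuous.
have phib : exists M : R, forall v, `|phi v| <= M.
  exists (a + 2 ^+ n.+1) => v; rewrite ger0_norm; last exact: S0.
  exact: stopped_le.
have sym : (\int[P]_w (S n.+1 (D w))%:E = \int[P]_w (S n.+1 (D' w))%:E)%E.
  transitivity (\int[P]_w (phi (mdiff_vec f n w))%:E)%E.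
    apply: eq_integral => w _; congr (_%:E).
    by apply: (@eq_stopped _ _ p lam K a n.+1 (D w)) => i ni; rewrite mxE inordK.
  apply: (etrans (csf phic phib)); apply: eq_integral => w _; congr (_%:E).
  apply: (@eq_stopped _ _ p lam K a n.+1) => i ni.
  by rewrite mxE -val_eqE/= inordK// /D' /D.
have sum : (\int[P]_w ((S n.+1 (D w))%:E + (S n.+1 (D' w))%:E) <=
    \int[P]_w (2%:E * (S n (D w))%:E))%E.
  apply: ge0_le_integral.
  - exact: measurableT.
  - by move=> w _; rewrite -EFinD lee_fin addr_ge0.
  - exact: emeasurable_funD.
  - exact: measurable_funeM.
  - move=> w _; rewrite -EFinD -EFinM lee_fin.
    have d'd i : (i < n)%N -> D' w i = D w i by move=> ni; rewrite /D' (ltn_eqF ni).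
    have d'n : D' w n = - D w n by rewrite /D' eqxx.
    exact: (stopped_step a0 step d'd d'n).
have S0E k d : (0 <= (S k d)%:E)%E by rewrite lee_fin.
have := sum.
rewrite (ge0_integralD P measurableT (fun w _ => S0E n.+1 (D w)) (mS n.+1)
  (fun w _ => S0E n.+1 (D' w)) (mS' n.+1)) -sym.
rewrite (ge0_integralZl_EFin P measurableT (fun w _ => S0E n (D w)) (mS n) (ler0n _ 2)).
by rewrite -mule2n -mule_natl lee_pmul2l.
Qed.

Lemma expectation_stopped_le1 n : (\int[P]_w (S n (D w))%:E <= 1)%E.
Proof.
elim: n => [|n IH]; last exact: le_trans (expectation_stopped_step n) IH.
rewrite (eq_integral (cst 1%E)) => [|w _]; last by rewrite /S stopped0.
by rewrite (integral_cst P measurableT 1%E) mul1e; exact: probability_le1.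
Qed.

Lemma expmart_maximal :
  (P [set w | exists n, (2 * a <= expmart p lam K n (D w))%R] <= a^-1%:E)%E.
Proof.
have mD i : strongly_measurable measurable (D ^~ i) by exact: mdiff_strongly_measurable.
pose H m := [set w | 2 * a <= expmart p lam K m (D w)].
have mH m : measurable (H m).
  rewrite /H -[X in measurable X]setTI.
  have := expmart_measurable mD p lam K m measurableT (measurable_itv `[2 * a, +oo[).
  by congr measurable; apply/seteqP; split => w /=; rewrite in_itv/= andbT.
(* Hits strictly before [n]: on [B n] the stopped process at time [n] is frozen at [a], so Markov's
   inequality gives [a * P (B n) <= 1]. *)
pose B n := \bigcup_(m in [set m | (m < n)%N]) H m.
have mB n : measurable (B n) by exact: bigcup_measurable.
have PB n : (P (B n) <= a^-1%:E)%E.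
  rewrite -(@lee_pmul2l _ a%:E) ?lte_fin// -EFinM divff ?gt_eqF//.
  apply: le_trans (expectation_stopped_le1 n).
  rewrite -integral_cst//.
  have mS : measurable_fun setT (fun w => (S n (D w))%:E).
    by apply/measurable_EFinP; exact: stopped_measurable.
  have S0 w : (0 <= (S n (D w))%:E)%E by rewrite lee_fin; exact: stopped_ge0.
  apply: (@le_trans _ _ (\int[P]_(w in B n) (S n (D w))%:E)%E); last first.
    exact: ge0_subset_integral.
  apply: ge0_le_integral => //.
  - by move=> w _; rewrite lee_fin ltW.
  - exact: measurable_funTS.
  - by move=> w [m mn Hm]; rewrite lee_fin /S (stopped_hit _ mn Hm).
have -> : [set w | exists n, (2 * a <= expmart p lam K n (D w))%R] = \bigcup_n B n.
  apply/seteqP; split => [w [m Hm]|w [n _ [m _ Hm]]]; last by exists m.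
  by exists m.+1 => //; exists m => //=.
(* Continuity from below carries the bound, uniform in [n], to the event of ever hitting. *)
have cv := @nondecreasing_cvg_mu _ _ _ P B mB (bigcupT_measurable _ mB) _.
apply: (cvge_to_le (cv _)); last by apply: nearW => n; exact: PB.
move=> n m nm; apply/subsetPset => w [k kn Hk]; exists k => //=.
exact: leq_trans kn nm.
Qed.

End MaximalInequality.

(** * Choice of the parameter and deduction of the tail bound *)

Lemma self_normalized_exponent (R : realType) (p K alpha beta r b x S : R) :
  0 < p -> 0 < K -> 0 <= alpha -> 0 < beta -> 0 < r -> 0 < b ->
  b^-1 <= S -> r * (alpha + beta * S) `^ (2 / p) <= x ->
  r `^ p * (beta ^+ 2 / (2 * b * K) + alpha * beta / K) <=
  r `^ (p / 2) * beta / K * x `^ (p / 2) -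
  K * (r `^ (p / 2) * beta / K) ^+ 2 / 2 * S.
Proof.
move=> p0 K0 alpha0 beta0 r0 b0 bS rx.
have S0 : 0 < S by apply: lt_le_trans bS; rewrite invr_gt0.
have y0 : 0 < alpha + beta * S by rewrite ltr_wpDl// mulr_gt0.
have rE : r `^ p = (r `^ (p / 2)) ^+ 2.
  by rewrite -powR_mulrn ?powR_ge0// -powRrM divfK.
(* Raising the hypothesis to the power [p / 2] undoes the exponent [2 / p] and makes the bound
   linear in [S]. *)
have h : r `^ (p / 2) * (alpha + beta * S) <= x `^ (p / 2).
  have := powRM (p / 2) (ltW r0) (powR_ge0 (alpha + beta * S) (2 / p)).
  rewrite -powRrM (_ : 2 / p * (p / 2) = 1); last by field; rewrite gt_eqF.
  rewrite powRr1 ?(ltW y0)// => <-.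
  apply: ge0_ler_powR => //; rewrite ?nnegrE.
  - by rewrite divr_ge0// ltW.
  - by rewrite mulr_ge0 ?powR_ge0// ltW.
  - by apply: le_trans rx; rewrite mulr_ge0 ?powR_ge0// ltW.
have r20 : 0 < r `^ (p / 2) by exact: powR_gt0.
rewrite rE; move: r20 h; move: (r `^ (p / 2)) (x `^ (p / 2)) => q z q0 h.
have -> : K * (q * beta / K) ^+ 2 / 2 * S = q ^+ 2 * beta ^+ 2 / (2 * K) * S.
  by field; rewrite gt_eqF.
have h1 : q * beta / K * (q * (alpha + beta * S)) <= q * beta / K * z.
  by rewrite ler_wpM2l// ltW// divr_gt0// mulr_gt0.
have h2 : q ^+ 2 * beta ^+ 2 / (2 * K) * b^-1 <= q ^+ 2 * beta ^+ 2 / (2 * K) * S.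
  by rewrite ler_wpM2l// divr_ge0// ?mulr_ge0 ?sqr_ge0// ltW.
(* The value [lam = q beta / K] maximizes [lam q beta - K lam^2 / 2], the coefficient of [S]. The
   gain is then twice the penalty, so one copy survives, and [S >= b^-1] bounds it below. *)
have E1 : q * beta / K * (q * (alpha + beta * S)) =
    q ^+ 2 * (alpha * beta / K) + 2 * (q ^+ 2 * beta ^+ 2 / (2 * K) * S).
  by field; rewrite gt_eqF.
have E2 : q ^+ 2 * (beta ^+ 2 / (2 * b * K) + alpha * beta / K) =
    q ^+ 2 * beta ^+ 2 / (2 * K) * b^-1 + q ^+ 2 * (alpha * beta / K).
  by field; rewrite !gt_eqF.
rewrite E2; move: h1; rewrite E1; move: h2.
move: (q ^+ 2 * beta ^+ 2 / (2 * K) * S) (q ^+ 2 * beta ^+ 2 / (2 * K) * b^-1)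
  (q ^+ 2 * (alpha * beta / K)) (q * beta / K * z) => A B C E; lra.
Qed.

Theorem theorem4p7 (R : realType) :
  exists D : R, 0 < D /\
  forall (p : R) (X : completeNormedModType R),
    1 < p <= 2 -> separable X -> (exists x : X, x != 0) ->
    p_uniformly_smooth p X ->
    exists K : R, 0 < K /\ K <= D * s_p p X /\
    forall (d : measure_display) (Omega : measurableType d)
      (P : probability Omega R) (F : nat -> set (set Omega))
      (f : nat -> Omega -> X),
      filtration F -> trivial_sigma (F 0%N) -> martingale P F f ->
      cond_symmetric P f ->
      forall alpha beta r b : R, 0 <= alpha -> 0 < beta -> 0 < r -> 0 < b ->
      (P [set w | (exists n : nat,
            r <= `|f n w - f 0%N w| / (alpha + beta * Spp p f n w) `^ (2 / p)
            /\ 0 < Spp p f n w /\ (Spp p f n w)^-1 <= b)%R]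
       <= (4 * expR (- (r `^ p * (beta ^+ 2 / (2 * b * K) + alpha * beta / K))))%R%:E)%E.
Proof.
(* The universal constant is the 20 of [coshR_norm_step], applied with [s = s_p p X], which is
   itself a smoothness constant. *)
exists 20; split=> // p X p12 _ X0 smX; have /andP[p1 p2] := p12.
have p0 : 0 < p by lra.
have hs := s_p_smooth_consts p2 X0 smX.
have s4 := smooth_consts_ge p2 X0 hs.
pose K := 20 * s_p p X; have K0 : 0 < K by rewrite /K; lra.
exists K; split=> //; split=> // d Omega P F f [_ Fm _] _ [fF _ _] csf.
move=> alpha beta r b alpha0 beta0 r0 b0.
have mf j : strongly_measurable measurable (f j).
  have [s [sF sf]] := fF j; exists s; split=> // n; have [? sFn] := sF n.
  by split=> // x; exact/(Fm j)/sFn.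
pose e := r `^ p * (beta ^+ 2 / (2 * b * K) + alpha * beta / K).
pose lam := r `^ (p / 2) * beta / K.
have lam0 : 0 <= lam by rewrite ltW// divr_gt0// mulr_gt0// powR_gt0.
(* The level [2 * a = expR e / 2] is what [cosh t >= exp t / 2] guarantees on the event; [a^-1] is
   the target bound. *)
pose a := expR e / 4; have a0 : 0 < a by rewrite divr_gt0// expR_gt0.
have := expmart_maximal mf csf p12 a0
  (fun x y => coshR_norm_step x y p12 s4 hs lam0).
have -> : a^-1 = 4 * expR (- e) by rewrite expRN invf_div.
apply: le_trans.
set A := [set w | _]; set B := [set w | _].
have mD i : strongly_measurable measurable (fun w => mdiff f i w).
  exact: mdiff_strongly_measurable.
have SE n w : Spp p f n w = pvar p n (fun i => mdiff f i w) by [].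
have mS n : measurable_fun setT (Spp p f n) by exact: (pvar_measurable mD).
pose g n w := `|f n w - f 0%N w| - r * (alpha + beta * Spp p f n w) `^ (2 / p).
have mg n : measurable_fun setT (g n).
  apply: measurable_funB.
    apply: (strongly_measurable_norm (strongly_measurableD (mf n) _)).
    exact: strongly_measurableN.
  apply: measurable_funM => //; apply: (measurableT_comp (measurable_powR _)).
  by apply: measurable_funD => //; exact: measurable_funM.
(* Both divisions are cleared, which is legitimate because [Spp] and hence the denominator are
   positive on the event; this exhibits [A] as a countable union of measurable sets. *)
have AE : A = \bigcup_n (Spp p f n @^-1` `[b^-1, +oo[ `&` g n @^-1` `[0, +oo[).
  apply/seteqP; split=> [w [n [h1 [h2 h3]]]|w [n _ []]].
    exists n => //; split; rewrite /= in_itv/= andbT.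
      by rewrite -[leRHS]invrK lef_pV2// posrE ?invr_gt0.
    move: h1; rewrite /g subr_ge0 ler_pdivlMr// powR_gt0//.
    by rewrite ltr_wpDl// mulr_gt0.
  rewrite /= !in_itv/= !andbT /g subr_ge0 => h1 h2.
  have S0 : 0 < Spp p f n w by apply: lt_le_trans h1; rewrite invr_gt0.
  exists n; split; last split=> //.
    by rewrite ler_pdivlMr// powR_gt0// ltr_wpDl// mulr_gt0.
  by rewrite -[leRHS]invrK lef_pV2// posrE ?invr_gt0.
have mA : measurable A.
  rewrite AE; apply: bigcupT_measurable => n; apply: measurableI.
    by rewrite -[X in measurable X]setTI; exact: mS.
  by rewrite -[X in measurable X]setTI; exact: mg.
have mB : measurable B.
  have -> : B = \bigcup_n
      ((fun w => expmart p lam K n (fun i => mdiff f i w)) @^-1` `[2 * a, +oo[).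
    apply/seteqP; split=> [w [n h]|w [n _]].
      by exists n => //=; rewrite in_itv/= andbT.
    by rewrite /= in_itv/= andbT => h; exists n.
  apply: bigcupT_measurable => n; rewrite -[X in measurable X]setTI.
  exact: (expmart_measurable mD).
apply: le_measure; rewrite ?inE// AE => w [n _ []].
rewrite /= !in_itv/= !andbT /g subr_ge0 => h1 h2; exists n.
have := self_normalized_exponent p0 K0 alpha0 beta0 r0 b0 h1 h2.
rewrite -/e -/lam -ler_expR expRD => h.
(* It remains to chain [expmart >= exp (lam |f_n - f_0|^(p/2) - K lam^2 S_n / 2) / 2 >= exp e /
   2]. *)
have -> : 2 * a = expR e / 2 by rewrite /a; lra.
rewrite /expmart psum_mdiff -SE.
have := coshR_ge_expR (lam * `|f n w - f 0%N w| `^ (p / 2)).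
have := expR_gt0 (- (K * lam ^+ 2 / 2 * Spp p f n w)).
move: h; move: (expR e) (expR (lam * _)) (coshR _) (expR (- _)) => A1 A2 A3 A4.
by nra.
Qed.
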